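(* For odd integers $p \geq 3$ let $f_p(x) = \frac{x^p - x}{p} + x^{(p+1)/2} + 1$. Then, as $p \to \infty$ through the odd integers, \[ M(f_p(x)) \sim \frac{1 + \sqrt{1 + 4/p^2}}{2} \] to all orders in $p$, meaning that for every integer $n$ the difference $M(f_p(x)) - \frac{1 + \sqrt{1 + 4/p^2}}{2}$ is $\mathcal{O}(p^{n})$ as $p \to \infty$. In particular, $\lim_{p \to \infty} M(f_p(x)) = 1$.
   Context: For a polynomial $P(x) = c\prod_{j=1}^d (x - \alpha_j) \in \mathbb{C}[x]$ with $c \neq 0$, its Mahler measure is $M(P(x)) = |c| \prod_{j=1}^d \max\{1, |\alpha_j|\}$. *)

(* Defs.v *)
From HB Require Import structures.
From mathcomp Require Import all_boot all_order all_algebra.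
From mathcomp Require Import all_classical all_reals all_analysis.
From mathcomp Require Import complex.

Set Implicit Arguments.
Unset Strict Implicit.
Unset Printing Implicit Defensive.

Import Order.TTheory GRing.Theory Num.Theory.
Import numFieldNormedType.Exports.

Local Open Scope classical_set_scope.
Local Open Scope ring_scope.

Definition cmod (R : rcfType) (z : R[i]) : R := complex.Re `|z|.

(* The roots of P listed with multiplicity. *)
Definition croots (R : rcfType) (P : {poly R[i]}) : seq R[i] :=
  sval (closed_field_poly_normal P).

Definition mahler (R : rcfType) (P : {poly R[i]}) : R :=
  cmod (lead_coef P) * \prod_(a <- croots P) Num.max 1 (cmod a).

(* The value does not depend on the ordering of the roots chosen in croots. *)
Lemma mahlerE (R : rcfType) (c : R[i]) (s : seq R[i]) : c != 0 ->
  mahler (c *: \prod_(a <- s) ('X - a%:P)) =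
  cmod c * \prod_(a <- s) Num.max 1 (cmod a).
Proof.
move=> c0; set P := c *: _.
have lcP : lead_coef P = c.
  by rewrite lead_coefZ (monicP (monic_prod_XsubC _ _ _)) mulr1.
rewrite /mahler lcP; congr (_ * _); apply: perm_big.
apply: prod_XsubC_eq; apply: (scalerI c0).
by rewrite -/P -{1}lcP /croots; case: closed_field_poly_normal => r /=.
Qed.

Definition fpoly (R : rcfType) (p : nat) : {poly R[i]} :=
  (p%:R)^-1 *: ('X^p - 'X) + 'X^((p + 1) %/ 2) + 1.

Definition odd_infty : set_system nat :=
  within [set p | odd p /\ (3 <= p)%N] \oo.

Global Instance odd_infty_filter : ProperFilter odd_infty.
Proof.
apply: Build_ProperFilter_ex => A [N _ NA].
have le3 : (3 <= N.*2 + 3)%N by rewrite leq_addl.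
have leN : (N <= N.*2 + 3)%N by rewrite -addnn -addnA leq_addr.
exists (N.*2 + 3)%N; apply: NA => //=; split=> //.
by rewrite oddD odd_double.
Qed.

(* Main.v *)
(** Write p = 2q + 1 and g(y) = y + (y^2 - 1) / p, so that f_p(x) = 1 + x g(x^q).
The product of f_p over the fibre x^q = y is F(y) = 1 - (- g(y))^q y, whence
M(F) = M(f_p)^q.  Let N_s denote the Mahler measure taken on the circle of
radius s; by Jensen's formula it only depends on, and increases with, the modulus
of the polynomial on that circle.  On |y| = 2 and |y| = 4 the term H = (- g)^q y
dominates 1 by a factor (3/2)^q, so N_s(F) and N_s(H) agree there up to a factor
1 + O((2/3)^q).  As |g| >= 1 for 1 <= |y| <= 4, F has no root with 1 < |y| < 4, so
that log N_s(F) is affine in log s on [1, 4] and N_1(F) = N_2(F)^2 / N_4(F); the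
same relation holds for H, and N_1(H) = M(g)^q = ((1 + sqrt (1 + 4 / p^2)) / 2)^q.
Taking q-th roots, M(f_p) and M(g) differ by O((2/3)^q). *)

Require Import Defs.
From mathcomp Require Import all_boot all_order all_algebra.
From mathcomp Require Import cyclic separable cyclotomic.
From mathcomp Require Import all_classical all_reals all_analysis.
From mathcomp Require Import complex.
From mathcomp Require Import ring lra zify.

Import Order.TTheory GRing.Theory Num.Theory.
Import numFieldNormedType.Exports.

Local Open Scope classical_set_scope.
Local Open Scope ring_scope.

Set Implicit Arguments.
Unset Strict Implicit.
Unset Printing Implicit Defensive.

Section RealPowers.

Lemma ler_of_exprn_le (R : archiRealFieldType) (C u v : R) : 0 <= v ->
  (forall n, (0 < n)%N -> u ^+ n <= C * v ^+ n) -> u <= v.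
Proof.
move=> v0 le_pow; rewrite leNgt; apply/negP => vu.
have u0 : 0 < u := le_lt_trans v0 vu.
have : C * (v / u) ^+ n @[n --> \oo] --> C * 0.
  apply: cvgMr; apply: cvg_expr.
  by rewrite ger0_norm ?divr_ge0 ?(ltW u0) // ltr_pdivrMr // mul1r.
rewrite mulr0 => /cvgr_lt/(_ 1 ltr01)[N _ /(_ N.+1 (leqnSn N))] /=.
by rewrite expr_div_n mulrA ltr_pdivrMr ?exprn_gt0 // mul1r ltNge le_pow.
Qed.

Lemma ler_dist_of_exp (R : realFieldType) (e u v : R) n :
    (0 < n)%N -> 0 <= e -> 0 <= u -> 0 <= v ->
    (1 - e) * v ^+ n <= u ^+ n <= (1 + e) * v ^+ n ->
  `|u - v| <= e * v.
Proof.
move=> n0 e0 u0 v0 /andP[lo up]; have vn0 : 0 <= v ^+ n by rewrite exprn_ge0.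
have u_le : u <= (1 + e) * v.
  rewrite -(ler_pXn2r n0) ?nnegrE ?mulr_ge0 ?addr_ge0 //.
  by rewrite (le_trans up) // exprMn ler_wpM2r // ler_eXnr // lerDl.
have u_ge : (1 - e) * v <= u.
  have [neg|pos] := ltP (1 - e) 0; first by nra.
  rewrite -(ler_pXn2r n0) ?nnegrE ?mulr_ge0 // (le_trans _ lo) // exprMn.
  by rewrite ler_wpM2r // ler_iXnr // gerBl.
by rewrite ler_norml; lra.
Qed.

Lemma log_affine_perturb (R : realFieldType) (d u1 u2 u4 v1 v2 v4 : R) :
    0 <= d <= 5^-1 -> 0 <= u1 -> 0 <= v1 -> 0 <= v2 -> 0 < v4 ->
    u1 * u4 = u2 ^+ 2 -> v1 * v4 = v2 ^+ 2 ->
    (1 - d) * v2 <= u2 <= (1 + d) * v2 ->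
    (1 - d) * v4 <= u4 <= (1 + d) * v4 ->
  (1 - 4 * d) * v1 <= u1 <= (1 + 4 * d) * v1.
Proof.
move=> /andP[d0 d5] u10 v10 v20 v40 u_affine v_affine.
move=> /andP[lo2 up2] /andP[lo4 up4].
have lo2_ge0 : 0 <= (1 - d) * v2 by rewrite mulr_ge0 //; lra.
have lo1 : (1 - d) ^+ 2 * v1 <= (1 + d) * u1.
  rewrite -(ler_pM2r v40) -mulrA v_affine -exprMn [leRHS]mulrAC.
  rewrite [leRHS]mulrC; apply: le_trans (ler_wpM2l u10 up4); rewrite u_affine.
  by rewrite lerXn2r ?nnegrE // (le_trans lo2_ge0).
have up1 : (1 - d) * u1 <= (1 + d) ^+ 2 * v1.
  rewrite -(ler_pM2r v40) -[leRHS]mulrA v_affine -exprMn mulrAC.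
  rewrite [leLHS]mulrC; apply: le_trans (ler_wpM2l u10 lo4) _; rewrite u_affine.
  by rewrite lerXn2r ?nnegrE ?(le_trans lo2_ge0) // (le_trans lo2).
by apply/andP; split; nra.
Qed.

Lemma exprn_le_geometric (R : realType) (x : R) m : 1 < x ->
  exists2 c, 0 < c & forall n : nat, n%:R ^+ m <= c * x ^+ n.
Proof.
move=> x1; have x0 : 0 < x := lt_trans ltr01 x1; have l0 := ln_gt0 x1.
exists (m`!%:R / ln x ^+ m) => [|n].
  by rewrite divr_gt0 ?exprn_gt0 // ltr0n fact_gt0.
rewrite mulrAC ler_pdivlMr ?exprn_gt0 // -exprMn.
rewrite [leRHS]mulrC -ler_pdivrMr ?ltr0n ?fact_gt0 //.
have -> : x ^+ n = expR (n%:R * ln x) by rewrite expRM_natl lnK.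
have nl0 : 0 <= n%:R * ln x by rewrite mulr_ge0 // ltW.
case: m => [|m]; first by rewrite fact0 divr1 -[leLHS]expR0 ler_expR.
by apply: le_trans (expR_ge1Dxn m nl0); rewrite lerDr.
Qed.

End RealPowers.

Section PrimitiveRoots.

Lemma closed_prim_root_exists (F : closedFieldType) n :
  n%:R != 0 :> F -> exists z : F, n.-primitive_root z.
Proof.
move=> nF0; have n_gt0 : (0 < n)%N by case: n nF0 => //; rewrite eqxx.
have [r] := closed_field_poly_normal ('X^n - 1 : {poly F}).
rewrite (monicP (monicXnsubC 1 n_gt0)) scale1r => Er.
have unity_r : all n.-unity_root r.
  by apply/allP=> z zr; rewrite /root_of_unity Er root_prod_XsubC.
have uniq_r : uniq r by rewrite -separable_prod_XsubC -Er separable_Xn_sub_1.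
have size_r : (n <= size r)%N.
  by rewrite -ltnS -(size_prod_XsubC r id) -Er size_XnsubC.
by have /hasP[z] := has_prim_root n_gt0 unity_r uniq_r size_r; exists z.
Qed.

Lemma num_closed_prim_root_exists (F : numClosedFieldType) n :
  (0 < n)%N -> exists z : F, n.-primitive_root z.
Proof.
by move=> n0; apply: closed_prim_root_exists; rewrite pnatr_eq0 -lt0n.
Qed.

Lemma prod_prim_root_subr (F : fieldType) n (z x y : F) : n.-primitive_root z ->
  \prod_(i < n) (x - z ^+ i * y) = x ^+ n - y ^+ n.
Proof.
move=> z_prim; have n_gt0 := prim_order_gt0 z_prim.
have [->|y0] := eqVneq y 0.
  under eq_bigr do rewrite mulr0 subr0.
  by rewrite prodr_const card_ord expr0n gtn_eqF // subr0.
have /(congr1 (horner^~ (x / y))) := factor_Xn_sub_1 z_prim.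
rewrite big_mkord horner_prod !hornerE expr_div_n => eq_div.
rewrite -[x ^+ n](divfK (expf_neq0 n y0)) -[X in _ - X]mul1r -mulrBl -eq_div.
rewrite -[n in y ^+ n]card_ord -prodr_const -big_split.
by apply: eq_bigr => i _ /=; rewrite !hornerE mulrBl divfK.
Qed.

Lemma sum_prim_root_exp (F : fieldType) n (z : F) j : n.-primitive_root z ->
  ~~ (n %| j)%N -> \sum_(i < n) (z ^+ i) ^+ j = 0.
Proof.
move=> z_prim nj; have /mulfI : z ^+ j - 1 != 0.
  by rewrite subr_eq0 -(prim_order_dvd z_prim).
apply; under eq_bigr do rewrite exprAC.
by rewrite mulr0 -subrX1 exprAC (prim_expr_order z_prim) expr1n subrr.
Qed.

Lemma sum_horner_prim_root (F : fieldType) n (z s : F) (P : {poly F}) :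
  n.-primitive_root z -> (size P <= n)%N ->
  \sum_(i < n) P.[z ^+ i * s] = P.[0] *+ n.
Proof.
move=> z_prim le_Pn; have n_gt0 := prim_order_gt0 z_prim.
under eq_bigr do rewrite (horner_coef_wide _ le_Pn).
rewrite exchange_big (bigD1 (Ordinal n_gt0)) //= [X in _ + X]big1 => [|j].
  rewrite addr0; under eq_bigr do rewrite expr0 mulr1.
  by rewrite sumr_const card_ord horner_coef0.
rewrite -val_eqE /= => j0; under eq_bigr do rewrite exprMn mulrCA.
rewrite -mulr_suml (sum_prim_root_exp z_prim) ?mul0r //.
by rewrite gtnNdvd ?lt0n.
Qed.

End PrimitiveRoots.

Section Modulus.
Variable R : rcfType.
Implicit Types (x y z : R[i]) (s : R).

Lemma cmod_ge0 z : 0 <= cmod z. Proof. exact: (@normr_ge0 _ (Rcomplex R)). Qed.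

Lemma cmod0 : cmod (0 : R[i]) = 0. Proof. exact: Normc.normc0. Qed.

Lemma cmod1 : cmod (1 : R[i]) = 1. Proof. exact: Normc.normc1. Qed.

Lemma cmodN x : cmod (- x) = cmod x. Proof. exact: normcN. Qed.

Lemma cmodJ x : cmod x^*%C = cmod x. Proof. by rewrite /cmod normcJ. Qed.

Lemma cmodM x y : cmod (x * y) = cmod x * cmod y.
Proof. exact: Normc.normcM. Qed.

Lemma cmodV x : cmod x^-1 = (cmod x)^-1. Proof. exact: Normc.normcV. Qed.

Lemma cmod_real s : cmod s%:C%C = `|s|.
Proof. by rewrite /cmod normc_def /= expr0n addr0 sqrtr_sqr. Qed.

Lemma cmod_nat n : cmod (n%:R : R[i]) = n%:R.
Proof. by rewrite -(rmorph_nat (real_complex R)) cmod_real normr_nat. Qed.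

Lemma cmod_prod (I : Type) (r : seq I) (P : pred I) (F : I -> R[i]) :
  cmod (\prod_(i <- r | P i) F i) = \prod_(i <- r | P i) cmod (F i).
Proof. exact: (big_morph _ cmodM cmod1). Qed.

Lemma cmodX x n : cmod (x ^+ n) = cmod x ^+ n.
Proof. by rewrite -[n]card_ord -!prodr_const cmod_prod. Qed.

Lemma ler_cmodD x y : cmod (x + y) <= cmod x + cmod y.
Proof. exact: le_normcD. Qed.

Lemma ler_cmod_sum (I : Type) (r : seq I) (F : I -> R[i]) :
  cmod (\sum_(i <- r) F i) <= \sum_(i <- r) cmod (F i).
Proof. exact: (@ler_norm_sum _ (Rcomplex R)). Qed.

Lemma lerB_cmod x y : cmod x - cmod y <= cmod (x - y).
Proof. exact: (@lerB_dist _ (Rcomplex R)). Qed.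

Lemma cmod_distC x y : cmod (x - y) = cmod (y - x).
Proof. by rewrite -cmodN opprB. Qed.

Lemma mulcJ z : z * z^*%C = (cmod z ^+ 2)%:C%C.
Proof. by rewrite -sqr_normc rmorphXn /cmod normc_def. Qed.

Lemma ler_Re_cmod z : complex.Re z <= cmod z.
Proof.
by rewrite (le_trans (ler_norm _)) // -lecR (le_trans (normc_ge_Re z)).
Qed.

End Modulus.

Section CircleMahler.
Variable R : rcfType.
Implicit Types (s : R) (a c z : R[i]) (r : seq R[i]) (P Q : {poly R[i]}).

(* By Jensen's formula this is the exponential of the mean of [log |P|] over the
   circle of radius [s]. *)
Definition circle_mahler s P : R :=
  cmod (lead_coef P) * \prod_(a <- croots P) Num.max s (cmod a).

Lemma circle_mahler1 P : circle_mahler 1 P = mahler P.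
Proof. by []. Qed.

Lemma croots_factor P : P = lead_coef P *: \prod_(a <- croots P) ('X - a%:P).
Proof. exact: svalP (closed_field_poly_normal P). Qed.

Lemma root_croots P a : P != 0 -> root P a = (a \in croots P).
Proof.
move=> P0; rewrite {1}[P]croots_factor rootZ ?lead_coef_eq0 //.
exact: root_prod_XsubC.
Qed.

Lemma circle_mahlerE s c r :
  circle_mahler s (c *: \prod_(a <- r) ('X - a%:P)) =
  cmod c * \prod_(a <- r) Num.max s (cmod a).
Proof.
have [->|c0] := eqVneq c 0.
  by rewrite scale0r /circle_mahler lead_coef0 cmod0 !mul0r.
have lc : lead_coef (c *: \prod_(a <- r) ('X - a%:P)) = c.
  by rewrite lead_coefZ (monicP (monic_prod_XsubC _ _ _)) mulr1.
rewrite /circle_mahler lc; congr (_ * _); apply/perm_big/prod_XsubC_eq.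
by apply: (scalerI c0); rewrite [RHS]croots_factor lc.
Qed.

Lemma circle_mahler_ge0 s P : 0 <= s -> 0 <= circle_mahler s P.
Proof.
move=> s0; rewrite mulr_ge0 ?cmod_ge0 ?prodr_ge0 // => a _.
by rewrite le_max s0.
Qed.

Lemma circle_mahlerM s P Q :
  circle_mahler s (P * Q) = circle_mahler s P * circle_mahler s Q.
Proof.
rewrite {1}[P]croots_factor {1}[Q]croots_factor -scalerAl -scalerAr scalerA.
by rewrite -big_cat circle_mahlerE cmodM big_cat mulrACA.
Qed.

Lemma circle_mahlerC s c : circle_mahler s c%:P = cmod c.
Proof.
by have := circle_mahlerE s c [::]; rewrite !big_nil alg_polyC mulr1.
Qed.

Lemma circle_mahlerZ s c P :
  circle_mahler s (c *: P) = cmod c * circle_mahler s P.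
Proof. by rewrite -mul_polyC circle_mahlerM circle_mahlerC. Qed.

Lemma circle_mahlerN s P : circle_mahler s (- P) = circle_mahler s P.
Proof. by rewrite -scaleN1r circle_mahlerZ cmodN cmod1 mul1r. Qed.

Lemma circle_mahler_exp s P n :
  circle_mahler s (P ^+ n) = circle_mahler s P ^+ n.
Proof.
elim: n => [|n IHn]; first by rewrite circle_mahlerC cmod1.
by rewrite !exprS circle_mahlerM IHn.
Qed.

Lemma circle_mahler_XsubC s a :
  circle_mahler s ('X - a%:P) = Num.max s (cmod a).
Proof.
by have := circle_mahlerE s 1 [:: a]; rewrite !big_seq1 scale1r cmod1 mul1r.
Qed.

Lemma circle_mahlerX s : 0 <= s -> circle_mahler s 'X = s.
Proof.
by move=> s0; rewrite -['X]subr0 -polyC0 circle_mahler_XsubC cmod0 max_l.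
Qed.

Lemma cmod_horner_croots P z :
  cmod P.[z] = cmod (lead_coef P) * \prod_(a <- croots P) cmod (z - a).
Proof.
rewrite {1}[P]croots_factor hornerZ horner_prod cmodM cmod_prod.
by under eq_bigr do rewrite !hornerE.
Qed.

Lemma circle_mahler_log_affine (r s t : R) P :
    0 <= r <= s -> s <= t -> r * t = s ^+ 2 ->
    (forall a, root P a -> cmod a <= r \/ t <= cmod a) ->
  circle_mahler r P * circle_mahler t P = circle_mahler s P ^+ 2.
Proof.
move=> /andP[r0 rs] st rt rootP; have [->|P0] := eqVneq P 0.
  by rewrite /circle_mahler lead_coef0 cmod0 !mul0r expr0n.
rewrite mulrACA exprMn -prodrXl -big_split /=; congr (_ * _).
apply: eq_big_seq => a; rewrite -root_croots // => /rootP[ar|ta].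
  by rewrite !max_l // ?(le_trans ar) // (le_trans rs).
by rewrite !max_r ?(le_trans _ ta) // ?(le_trans rs).
Qed.

End CircleMahler.

Section MaximumModulus.
Variable R : rcfType.
Implicit Types (s : R) (a y : R[i]) (P : {poly R[i]}).

Lemma horner0_le_circle s P : 0 <= s ->
  exists y, cmod y = s /\ cmod P.[0] <= cmod P.[y].
Proof.
move=> s0; have [z] := num_closed_prim_root_exists R[i] (ltn0Sn (size P)).
set n := (size P).+1 => z_prim.
have cmod_z : cmod z = 1.
  apply/eqP; rewrite -(@pexpr_eq1 _ _ n) ?cmod_ge0 //.
  by rewrite -cmodX (prim_expr_order z_prim) cmod1.
pose y (i : 'I_n) := z ^+ i * s%:C%C.
have [/existsP[i Pi]|/existsPn small] :=
    boolP [exists i : 'I_n, cmod P.[0] <= cmod P.[y i]].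
  by exists (y i); rewrite cmodM cmodX cmod_z expr1n mul1r cmod_real ger0_norm.
have: cmod P.[0] *+ n <= \sum_(i < n) cmod P.[y i].
  rewrite -mulr_natl -cmod_nat -cmodM mulr_natl.
  by rewrite -(sum_horner_prim_root s%:C%C z_prim (leqnSn _)) ler_cmod_sum.
rewrite -[n in _ *+ n]card_ord -sumr_const leNgt ltr_sum //.
  by apply/hasP; exists ord0; rewrite ?mem_index_enum.
by move=> i _; rewrite ltNge.
Qed.

(* The Blaschke trick: when [a] lies inside the circle of radius [s], the factor
   ['X - a] is replaced by its reflection in that circle. *)
Definition reflect_XsubC s a : {poly R[i]} :=
  if cmod a <= s then s%:C%C%:P - (a^*%C / s%:C%C) *: 'X else 'X - a%:P.

Lemma cmod_horner0_reflect_XsubC s a :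
  cmod (reflect_XsubC s a).[0] = Num.max s (cmod a).
Proof.
rewrite /reflect_XsubC; case: leP => [as_|sa].
  by rewrite !hornerE subr0 cmod_real ger0_norm // (le_trans (cmod_ge0 a)).
by rewrite !hornerE cmodN.
Qed.

Lemma cmod_horner_reflect_XsubC s a y : 0 < s -> cmod y = s ->
  cmod (reflect_XsubC s a).[y] = cmod (y - a).
Proof.
move=> s0 ys; rewrite /reflect_XsubC; case: ifP => _; last by rewrite !hornerE.
have sC0 : s%:C%C != 0 :> R[i] by rewrite fmorph_eq0 gt_eqF.
rewrite !hornerE (_ : _ - _ = (y - a)^*%C * y / s%:C%C).
  rewrite !cmodM cmodJ cmodV cmod_real gtr0_norm // ys.
  by rewrite mulfK // gt_eqF.
rewrite rmorphB mulrBl [y^*%C * y]mulrC mulcJ ys rmorphXn mulrBl expr2 mulfK //.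
by rewrite mulrAC.
Qed.

Lemma circle_mahler_attained s P : 0 < s ->
  exists y, cmod y = s /\ circle_mahler s P <= cmod P.[y].
Proof.
move=> s0; pose Q := lead_coef P *: \prod_(a <- croots P) reflect_XsubC s a.
have [y [ys le_Q]] := horner0_le_circle Q (ltW s0).
exists y; split=> //; move: le_Q.
rewrite [cmod P.[y]]cmod_horner_croots !hornerZ !horner_prod !cmodM !cmod_prod.
under eq_bigr do rewrite cmod_horner0_reflect_XsubC.
by under [X in _ <= _ * X]eq_bigr do rewrite cmod_horner_reflect_XsubC //.
Qed.

End MaximumModulus.

Section Graeffe.
Variable R : rcfType.
Implicit Types (s : R) (x y z : R[i]) (P : {poly R[i]}).

Definition graeffe n P : {poly R[i]} :=
  lead_coef P ^+ n *: \prod_(a <- croots P) ('X - (a ^+ n)%:P).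

Lemma cmod_horner_graeffe_croots n P y :
  cmod (graeffe n P).[y] =
  cmod (lead_coef P) ^+ n * \prod_(a <- croots P) cmod (y - a ^+ n).
Proof.
rewrite hornerZ horner_prod cmodM cmodX cmod_prod.
by under eq_bigr do rewrite !hornerE.
Qed.

Lemma cmod_horner_graeffe_exp n z x P : n.-primitive_root z ->
  cmod (graeffe n P).[x ^+ n] = \prod_(i < n) cmod P.[z ^+ i * x].
Proof.
move=> z_prim; rewrite cmod_horner_graeffe_croots.
under [RHS]eq_bigr do rewrite cmod_horner_croots.
rewrite big_split prodr_const card_ord exchange_big; congr (_ * _).
apply: eq_bigr => a _; rewrite cmod_distC -(prod_prim_root_subr a x z_prim).
by rewrite cmod_prod; apply: eq_bigr => i _; rewrite cmod_distC.
Qed.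

Lemma circle_mahler_graeffe n s P : 0 <= s ->
  circle_mahler (s ^+ n) (graeffe n P) = circle_mahler s P ^+ n.
Proof.
move=> s0; pose r := [seq a ^+ n | a <- croots P].
have := circle_mahlerE (s ^+ n) (lead_coef P ^+ n) r.
rewrite !big_map => ->; rewrite cmodX exprMn -prodrXl; congr (_ * _).
apply: eq_bigr => a _; rewrite cmodX; have a0 := cmod_ge0 a.
have [sa|/ltW sa] := leP s (cmod a); first by rewrite max_r // lerXn2r ?nnegrE.
by rewrite max_l // lerXn2r ?nnegrE.
Qed.

Lemma cmod_horner_graeffe_le n s y P : 0 <= s -> cmod y = s ^+ n ->
  cmod (graeffe n P).[y] <= 2 ^+ size (croots P) * circle_mahler s P ^+ n.
Proof.
move=> s0 ys; rewrite cmod_horner_graeffe_croots exprMn mulrCA.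
rewrite ler_wpM2l ?exprn_ge0 ?cmod_ge0 //.
rewrite -prodrXl -[size _]count_predT -iter_mulr_1 -big_const_seq -big_split /=.
apply: ler_prod => a _; rewrite cmod_ge0 (le_trans (ler_cmodD _ _)) //=.
rewrite cmodN cmodX ys mulr_natl mulr2n.
by apply: lerD; apply: lerXn2r;
  rewrite ?nnegrE ?le_max ?s0 ?lexx ?cmod_ge0 ?orbT.
Qed.

End Graeffe.

Section CircleComparison.
Variable R : realType.
Implicit Types (s : R) (P Q : {poly R[i]}).

(* Both sides are compared after [n]-th powers: averaging over the [n]-th roots
   of unity costs only a factor independent of [n]. *)
Lemma ler_circle_mahler s P Q : 0 < s ->
  (forall y, cmod y = s -> cmod P.[y] <= cmod Q.[y]) ->
  circle_mahler s P <= circle_mahler s Q.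
Proof.
move=> s0 le_PQ.
apply: (@ler_of_exprn_le _ (2 ^+ size (croots Q))) => [|n n0].
  by rewrite circle_mahler_ge0 ?ltW.
have [z z_prim] := num_closed_prim_root_exists R[i] n0.
have [u [us le_u]] := circle_mahler_attained (graeffe n P) (exprn_gt0 n s0).
rewrite -(circle_mahler_graeffe _ _ (ltW s0)) (le_trans le_u) //.
apply: le_trans (cmod_horner_graeffe_le _ (ltW s0) us).
rewrite -(rootCK n0 u) !(cmod_horner_graeffe_exp _ _ z_prim).
apply: ler_prod => i _; rewrite cmod_ge0; apply: le_PQ.
apply: (pexpIrn n0); rewrite ?nnegrE ?cmod_ge0 ?(ltW s0) //.
rewrite -us -cmodX exprMn exprAC (prim_expr_order z_prim) expr1n mul1r.
by rewrite rootCK.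
Qed.

Lemma eq_circle_mahler s P Q : 0 < s ->
  (forall y, cmod y = s -> cmod P.[y] = cmod Q.[y]) ->
  circle_mahler s P = circle_mahler s Q.
Proof.
move=> s0 eq_PQ; apply/eqP.
by rewrite eq_le !ler_circle_mahler // => y /eq_PQ->.
Qed.

Lemma circle_mahler_perturb (d s : R) P Q : 0 < s -> 0 <= d <= 1 ->
  (forall y, cmod y = s -> cmod (P.[y] - Q.[y]) <= d * cmod Q.[y]) ->
  (1 - d) * circle_mahler s Q <= circle_mahler s P
    <= (1 + d) * circle_mahler s Q.
Proof.
move=> s0 /andP[d0 d1] near_PQ.
have cmod_scale (c : R) : 0 <= c -> cmod c%:C%C = c.
  by move=> c0; rewrite cmod_real ger0_norm.
have d1B : 0 <= 1 - d by rewrite subr_ge0.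
have d1D : 0 <= 1 + d by rewrite addr_ge0.
rewrite -[1 - d]cmod_scale // -[1 + d]cmod_scale // -!circle_mahlerZ.
apply/andP; split; apply: ler_circle_mahler => // y ys;
  rewrite hornerZ cmodM cmod_scale //; have := near_PQ y ys.
  have := lerB_cmod Q.[y] (Q.[y] - P.[y]).
  by rewrite subKr [cmod (Q.[y] - _)]cmod_distC; lra.
by have := ler_cmodD (P.[y] - Q.[y]) Q.[y]; rewrite subrK; lra.
Qed.

End CircleComparison.

Section Quadratic.
Variable R : rcfType.
Implicit Types (p : nat) (s : R) (y : R[i]).

Definition quad p : {poly R[i]} := 'X + p%:R^-1 *: ('X^2 - 1).

Definition quad_mahler p : R := (1 + Num.sqrt (1 + 4 / p%:R ^+ 2)) / 2.

Lemma quad_mahler_root p : quad_mahler p ^+ 2 - quad_mahler p = p%:R ^- 2.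
Proof.
have : Num.sqrt (1 + 4 / p%:R ^+ 2) ^+ 2 = 1 + 4 / p%:R ^+ 2 :> R.
  by rewrite sqr_sqrtr // addr_ge0 // mulr_ge0 // invr_ge0 sqr_ge0.
by rewrite /quad_mahler; lra.
Qed.

Lemma quad_mahler_ge1 p : 1 <= quad_mahler p.
Proof.
have : 1 <= Num.sqrt (1 + 4 / p%:R ^+ 2 : R).
  by rewrite -[leLHS]sqrtr1 ler_wsqrtr // lerDl mulr_ge0 // invr_ge0 sqr_ge0.
by rewrite /quad_mahler; lra.
Qed.

Lemma quad_mahler_le p : quad_mahler p <= 1 + p%:R^-1.
Proof.
have k0 : 0 <= p%:R^-1 :> R by rewrite invr_ge0.
have := quad_mahler_root p; rewrite -exprVn; have := quad_mahler_ge1 p; nra.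
Qed.

Lemma quad_factor p : (0 < p)%N ->
  quad p = p%:R^-1 *:
    (('X - (- (p%:R * quad_mahler p))%:C%C%:P) *
     ('X - (p%:R * (quad_mahler p - 1))%:C%C%:P)).
Proof.
move=> p0; have pR0 : p%:R != 0 :> R by rewrite pnatr_eq0 -lt0n.
set A := quad_mahler p; pose b := - (p%:R * A); pose c := p%:R * (A - 1).
have bDc : b + c = - p%:R by rewrite /b /c; ring.
have bMc : b * c = -1.
  transitivity (- (p%:R ^+ 2 * (A ^+ 2 - A))); first by rewrite /b /c; ring.
  by rewrite quad_mahler_root divff ?expf_neq0.
rewrite -/b -/c; move: b c bDc bMc => b c bDc bMc.
have -> : ('X - b%:C%C%:P) * ('X - c%:C%C%:P : {poly R[i]}) =
    'X^2 - (b + c)%:C%C%:P * 'X + (b * c)%:C%C%:P.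
  by rewrite !rmorphD !rmorphM /=; ring.
rewrite bDc bMc rmorphN rmorph_nat rmorphN1 !polyCN mulNr opprK mul_polyC.
rewrite addrAC scalerDr scalerA mulVf ?pnatr_eq0 -?lt0n // scale1r.
by rewrite [RHS]addrC.
Qed.

Lemma circle_mahler_quad p s : (0 < p)%N -> 1 <= s <= p%:R ->
  circle_mahler s (quad p) = s * quad_mahler p.
Proof.
move=> p0 /andP[s1 sp]; have pR0 : 0 < p%:R :> R by rewrite ltr0n.
have A1 := quad_mahler_ge1 p; have A2 := quad_mahler_le p.
rewrite quad_factor // circle_mahlerZ circle_mahlerM !circle_mahler_XsubC.
rewrite cmodV cmod_nat !cmod_real normrN.
rewrite !ger0_norm ?mulr_ge0 ?subr_ge0 ?(le_trans ler01 A1) //.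
have large_root : s <= p%:R * quad_mahler p.
  by rewrite (le_trans sp) // ler_peMr // ltW.
have small_root : p%:R * (quad_mahler p - 1) <= s.
  by rewrite (le_trans _ s1) // -ler_pdivlMl // mulr1 lerBlDl.
by rewrite max_r // max_l // -[_ * s]mulrA mulKf ?gt_eqF // mulrC.
Qed.

Lemma cmod_horner_quad_ge p y : 1 <= cmod y ->
  cmod y - (cmod y ^+ 2 - 1) / p%:R <= cmod (quad p).[y].
Proof.
move=> y1; have y0 : 0 < cmod y := lt_le_trans ltr01 y1.
have Re_y : - cmod y <= complex.Re y.
  by rewrite lerNl -cmodN (le_trans _ (ler_Re_cmod _)) // raddfN.
have Re_gy : complex.Re ((quad p).[y] * y^*%C) =
    cmod y ^+ 2 + (cmod y ^+ 2 - 1) / p%:R * complex.Re y.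
  rewrite /quad; have -> : p%:R^-1 = (p%:R^-1)%:C%C :> R[i].
    by rewrite fmorphV rmorph_nat.
  have := mulcJ y; rewrite !hornerE.
  by case: y {y0 y1 Re_y} => u v /= [<- _]; ring.
have := ler_Re_cmod ((quad p).[y] * y^*%C).
rewrite Re_gy cmodM cmodJ => le_gy.
rewrite -(ler_pM2r y0) (le_trans _ le_gy) //.
rewrite mulrBl -expr2 lerD2l -mulrN ler_wpM2l //.
by rewrite mulr_ge0 ?invr_ge0 // subr_ge0 exprn_ege1.
Qed.

Lemma cmod_horner_quad_ge1 p y : 1 <= cmod y <= p%:R - 1 ->
  1 <= cmod (quad p).[y].
Proof.
move=> /andP[y1 yp]; apply: le_trans (cmod_horner_quad_ge p y1).
have p0 : 0 < p%:R :> R by lra.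
by rewrite lerBrDl -lerBrDr ler_pdivrMr //; nra.
Qed.

End Quadratic.

Section Fpoly.
Variable R : realType.
Implicit Types (q : nat) (s : R) (x y : R[i]).

(* [(fiber_poly q).[y]] is the product of [(fpoly R q.*2.+1).[x]] over the fibre
   [x ^+ q = y]. *)
Definition fiber_main q : {poly R[i]} := (- quad R q.*2.+1) ^+ q * 'X.

Definition fiber_poly q : {poly R[i]} := 1 - fiber_main q.

Lemma horner_fiber_main q y :
  (fiber_main q).[y] = (- (quad R q.*2.+1).[y]) ^+ q * y.
Proof. by rewrite /fiber_main !hornerE. Qed.

Lemma horner_fiber_poly q y :
  (fiber_poly q).[y] = 1 - (- (quad R q.*2.+1).[y]) ^+ q * y.
Proof. by rewrite /fiber_poly hornerD hornerN hornerC horner_fiber_main. Qed.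

Lemma horner_fpoly q x :
  (fpoly R q.*2.+1).[x] = 1 + x * (quad R q.*2.+1).[x ^+ q].
Proof.
rewrite /fpoly /quad; have -> : ((q.*2.+1 + 1) %/ 2 = q.+1)%N by lia.
by rewrite !hornerE !exprS -muln2 exprM; ring.
Qed.

Lemma cmod_horner_graeffe_fpoly q y : (0 < q)%N ->
  cmod (graeffe q (fpoly R q.*2.+1)).[y] = cmod (fiber_poly q).[y].
Proof.
move=> q0; have [z z_prim] := num_closed_prim_root_exists R[i] q0.
rewrite -(rootCK q0 y) (cmod_horner_graeffe_exp _ _ z_prim).
move: (q.-root y) => x; rewrite -cmod_prod; congr cmod.
set g := (quad R q.*2.+1).[x ^+ q].
transitivity (\prod_(i < q) (1 - z ^+ i * (- g * x))).
  apply: eq_bigr => i _; rewrite horner_fpoly exprMn exprAC.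
  rewrite (prim_expr_order z_prim) expr1n mul1r -/g.
  by rewrite mulNr mulrN opprK -mulrA [x * g]mulrC.
by rewrite (prod_prim_root_subr _ _ z_prim) expr1n exprMn horner_fiber_poly.
Qed.

Lemma mahler_fpoly_exp q : (0 < q)%N ->
  mahler (fpoly R q.*2.+1) ^+ q = circle_mahler 1 (fiber_poly q).
Proof.
move=> q0; rewrite -circle_mahler1 -(circle_mahler_graeffe _ _ ler01) expr1n.
by apply: eq_circle_mahler => // y _; apply: cmod_horner_graeffe_fpoly.
Qed.

Lemma fiber_poly_no_root q y : (0 < q)%N -> 1 < cmod y <= q.*2%:R ->
  ~~ root (fiber_poly q) y.
Proof.
move=> q0 /andP[y1 yq]; apply/negP => /rootP; rewrite horner_fiber_poly.
move=> /subr0_eq/(congr1 (@cmod R)); rewrite cmod1 cmodM cmodX cmodN => prod1.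
have : 1 <= cmod (quad R q.*2.+1).[y].
  by apply: cmod_horner_quad_ge1; rewrite (ltW y1) -natr1 addrK.
by move=> /(exprn_ege1 q); nra.
Qed.

Lemma mahler_fpoly_exp_log_affine q s :
    (0 < q)%N -> 1 <= s -> s ^+ 2 <= q.*2%:R ->
  mahler (fpoly R q.*2.+1) ^+ q * circle_mahler (s ^+ 2) (fiber_poly q) =
  circle_mahler s (fiber_poly q) ^+ 2.
Proof.
move=> q0 s1 s2_q; rewrite mahler_fpoly_exp //.
apply: circle_mahler_log_affine => [|||y root_y]; rewrite ?mul1r ?ler01 //.
  by rewrite ler_eXnr.
have [y1|y1] := leP (cmod y) 1; [by left|right].
rewrite leNgt; apply/negP => ys; move: root_y; apply/negP.
by apply: fiber_poly_no_root; rewrite ?y1 ?(le_trans (ltW ys)).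
Qed.

Lemma circle_mahler_fiber_main q s : (0 < q)%N -> 1 <= s <= q.*2.+1%:R ->
  circle_mahler s (fiber_main q) = s ^+ q.+1 * quad_mahler R q.*2.+1 ^+ q.
Proof.
move=> q0 /[dup] /andP[s1 _] s_p; have s0 : 0 <= s by lra.
rewrite circle_mahlerM circle_mahlerX // circle_mahler_exp circle_mahlerN.
by rewrite circle_mahler_quad // exprMn mulrC mulrA -exprS.
Qed.

Lemma cmod_horner_fiber_main_ge q y : (5 <= q)%N -> 2 <= cmod y <= 4 ->
  (3 / 2) ^+ q <= cmod (fiber_main q).[y].
Proof.
move=> q5 /andP[y2 y4]; have y1 : 1 <= cmod y by lra.
have quad_ge : 3 / 2 <= cmod (quad R q.*2.+1).[y].
  apply: le_trans (cmod_horner_quad_ge q.*2.+1 y1).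
  have : (cmod y ^+ 2 - 1) / q.*2.+1%:R <= (cmod y ^+ 2 - 1) / 11.
    rewrite ler_wpM2l ?subr_ge0 ?exprn_ege1 //.
    by rewrite lef_pV2 ?posrE ?ltr0n // ler_nat; lia.
  have : cmod y ^+ 2 <= 6 * cmod y - 8 by nra.
  by move: (cmod y ^+ 2) (_ / q.*2.+1%:R) => r2 u; lra.
rewrite horner_fiber_main cmodM cmodX cmodN -[leLHS]mulr1.
by rewrite ler_pM ?exprn_ge0 ?lerXn2r ?nnegrE //; lra.
Qed.

Lemma circle_mahler_fiber_poly q s (d := (2 / 3) ^+ q) :
    (5 <= q)%N -> 2 <= s <= 4 ->
  (1 - d) * (s ^+ q.+1 * quad_mahler R q.*2.+1 ^+ q)
    <= circle_mahler s (fiber_poly q)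
    <= (1 + d) * (s ^+ q.+1 * quad_mahler R q.*2.+1 ^+ q).
Proof.
move=> q5 /[dup] s24 /andP[s2 s4].
have q0 : (0 < q)%N by apply: leq_trans q5.
have p11 : 11 <= q.*2.+1%:R :> R by rewrite ler_nat; lia.
have s_p : 1 <= s <= q.*2.+1%:R by lra.
have s0 : 0 < s by lra.
have d01 : 0 <= d <= 1 by rewrite /d exprn_ge0 ?exprn_ile1 //; lra.
rewrite -circle_mahler_fiber_main // -(circle_mahlerN s (fiber_main q)).
apply: circle_mahler_perturb => // y ys.
rewrite /fiber_poly hornerD addrK hornerC hornerN cmodN cmod1.
have : (3 / 2) ^+ q <= cmod (fiber_main q).[y].
  by apply: cmod_horner_fiber_main_ge; rewrite ?ys.
move/(ler_wpM2l (proj1 (andP d01))); apply: le_trans.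
by rewrite -exprMn (_ : 2 / 3 * (3 / 2) = 1) ?expr1n //; lra.
Qed.

End Fpoly.

Section Asymptotics.
Variable R : realType.

Lemma mahler_fpoly_exp_bounds q (d := 4 * (2 / 3) ^+ q)
    (M := mahler (fpoly R q.*2.+1)) (A := quad_mahler R q.*2.+1) : (5 <= q)%N ->
  (1 - d) * A ^+ q <= M ^+ q <= (1 + d) * A ^+ q.
Proof.
move=> q5; have q0 : (0 < q)%N by apply: leq_trans q5.
have q4 : 2 ^+ 2 <= q.*2%:R :> R by rewrite -natrX ler_nat; lia.
have A0 : 0 < A ^+ q.
  by rewrite exprn_gt0 // (lt_le_trans ltr01) ?quad_mahler_ge1.
have M0 : 0 <= M ^+ q.
  by rewrite exprn_ge0 // -[M]circle_mahler1 circle_mahler_ge0.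
have eps_le : 0 <= (2 / 3 : R) ^+ q <= 5^-1.
  apply/andP; split; first by rewrite exprn_ge0 //; lra.
  apply: (@le_trans _ _ ((2 / 3) ^+ 5)); last by rewrite !exprS; lra.
  by rewrite ler_wiXn2l //; lra.
have near2 := @circle_mahler_fiber_poly R q 2 q5 ltac:(lra).
have near4 := @circle_mahler_fiber_poly R q (2 ^+ 2) q5 ltac:(lra).
have affine := mahler_fpoly_exp_log_affine q0 (ler1n R 2) q4.
apply: (log_affine_perturb eps_le M0 (ltW A0) _ _ affine _ near2 near4).
- by rewrite mulr_ge0 ?(ltW A0) ?exprn_ge0.
- by rewrite mulr_gt0 // exprn_gt0 ?exprn_gt0.
- by rewrite exprAC; move: (A ^+ q) => ?; ring.
Qed.

Lemma mahler_fpoly_dist q : (5 <= q)%N ->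
  `|mahler (fpoly R q.*2.+1) - quad_mahler R q.*2.+1| <= 8 * (2 / 3) ^+ q.
Proof.
move=> q5; have q0 : (0 < q)%N by apply: leq_trans q5.
have d0 : 0 <= (2 / 3) ^+ q :> R by rewrite exprn_ge0 //; lra.
have A1 := quad_mahler_ge1 R q.*2.+1.
have A2 : quad_mahler R q.*2.+1 <= 2.
  rewrite (le_trans (quad_mahler_le R _)) // -[2]/(1 + 1) lerD2l.
  by rewrite invf_le1 ?ler1n ?ltr0n.
apply: le_trans (ler_dist_of_exp q0 _ _ _ (mahler_fpoly_exp_bounds q5)) _.
- by rewrite mulr_ge0.
- by rewrite -circle_mahler1 circle_mahler_ge0.
- exact: le_trans A1.
- by nra.
Qed.

Lemma mahler_fpoly_dist_exp m :
  exists2 c : R, 0 < c & forall p, odd p -> (11 <= p)%N ->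
    `|mahler (fpoly R p) - quad_mahler R p| <= c / p%:R ^+ m.
Proof.
have [|c c0 geo] := @exprn_le_geometric R (3 / 2) m; first by lra.
exists (8 * 3 ^+ m * c) => [|p p_odd p11].
  by rewrite !mulr_gt0 ?exprn_gt0.
have pE : p = p./2.*2.+1 by rewrite -[LHS]odd_double_half p_odd.
move: p./2 pE => q pE; subst p; have q5 : (5 <= q)%N by lia.
apply: le_trans (mahler_fpoly_dist q5) _.
rewrite ler_pdivlMr ?exprn_gt0 ?ltr0n // -!mulrA ler_pM2l //.
have exp_p_le : q.*2.+1%:R ^+ m <= 3 ^+ m * (c * (3 / 2) ^+ q).
  apply: le_trans (ler_wpM2l _ (geo q)); rewrite ?exprn_ge0 // -exprMn.
  by rewrite lerXn2r ?nnegrE ?mulr_ge0 // -natrM ler_nat; lia.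
apply: le_trans (ler_wpM2l _ exp_p_le) _; first by rewrite exprn_ge0 //; lra.
rewrite mulrCA [_ * (c * _)]mulrCA -exprMn.
by rewrite (_ : 2 / 3 * (3 / 2) = 1) ?expr1n ?mulr1 //; lra.
Qed.

Lemma mahler_fpoly_dist1 :
  exists2 c : R, 0 < c & forall p, odd p -> (11 <= p)%N ->
    `|mahler (fpoly R p) - 1| <= c / p%:R.
Proof.
have [c c0 dist_c] := mahler_fpoly_dist_exp 1.
exists (c + 1) => [|p p_odd p11]; first by rewrite addr_gt0.
have := dist_c p p_odd p11; rewrite expr1 mulrDl mul1r.
have := quad_mahler_ge1 R p; have := quad_mahler_le R p.
by rewrite !ler_norml; lra.
Qed.

End Asymptotics.

Theorem theorem2 (R : realType) :
  (forall n : int,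
     (fun p : nat => mahler (fpoly R p)
                     - (1 + Num.sqrt (1 + 4 / p%:R ^+ 2)) / 2)
     =O_odd_infty (fun p : nat => (p%:R : R) ^ n))
  /\ mahler (fpoly R p) @[p --> odd_infty] --> (1 : R).
Proof.
split=> [n|].
  have [c c0 dist_c] := mahler_fpoly_dist_exp R `|n|%N.
  apply/eqO_exP; exists c => //; exists 11%N => // p /= p11 [p_odd _].
  apply: le_trans (dist_c p p_odd p11) _; rewrite ler_pM2l //.
  have p1 : 1 <= p%:R :> R by rewrite ler1n (leq_trans _ p11).
  rewrite ger0_norm ?exprz_ge0 // exprnN ler_weXz2l //.
  by rewrite abszE lerNnormlW.
have [c c0 dist_c] := mahler_fpoly_dist1 R.
apply/cvgrPdist_le => e e0; exists (maxn 11 (Num.bound (c / e))) => // p /=.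
rewrite geq_max => /andP[p11 c_e] [p_odd _].
rewrite distrC (le_trans (dist_c p p_odd p11)) //.
rewrite ler_pdivrMr ?ltr0n ?(leq_trans _ p11) //.
rewrite mulrC -ler_pdivrMr // ltW // (lt_le_trans (archi_boundP _)) ?ler_nat //.
by rewrite divr_ge0 ?ltW.
Qed.
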